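(* The Jones projections $\frac1{|L|}\sum_{g\in L}\lambda(g)$ of the following subgroups $L$ of $D_{2n}$ are Jones projections of coideal subalgebras of $KD(n)$ of dimension the order of the subgroup; if the subgroup is commutative, then so is the coideal subalgebra: - $H_r=\{1,a^n,ba^r,ba^{r+n}\}$ for $r=0,\dots,n-1$; - $A_k$, the subgroup generated by $a^k$, for $k$ such that $2n=kd$; - $B_k$, the subgroup generated by $a^k$ and $b$, for $k$ such that $2n=kd$ (with $k,d$ positive integers).
   Context: A coideal subalgebra of a finite-dimensional Kac algebra ($C^*$-Hopf algebra) $K$ is a unital $*$-subalgebra $I$ with $\Delta(I)\subset K\otimes I$. Its Jones projection $p_I$ is the unique nonzero projection in $I$ with $yp_I=\varepsilon(y)p_I$ for all $y\in I$. $KD(n)$ ($n\ge1$): let $D_{2n}=\langle a,b\mid a^{2n}=b^2=1,\ ba=a^{-1}b\rangle$ (order $4n$), with canonical basis $\lambda(g)$ of $\mathbb{C}[D_{2n}]$, and $\Delta_s(\lambda(g))=\lambda(g)\otimes\lambda(g)$. Put $h_1=1,h_2=a^n,h_3=b,h_4=ba^n$, $\nu=-1+2\mathrm{i}$, and $\Omega=\sum_{i,j}c_{i,j}\lambda(h_i)\otimes\lambda(h_j)$ with $$(c_{i,j})=\frac18\begin{pmatrix}5&1&1&1\\1&1&\bar\nu&\nu\\1&\nu&1&\bar\nu\\1&\bar\nu&\nu&1\end{pmatrix}.$$ $\Omega$ is unitary. $KD(n)$ is the $*$-algebra $\mathbb{C}[D_{2n}]$ with its usual counit and antipode and the coproduct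 $\Delta(x)=\Omega\Delta_s(x)\Omega^*$. *)

(* Defs.v *)
From HB Require Import structures.
From mathcomp Require Import all_boot all_order all_algebra.
From mathcomp Require Import all_fingroup all_solvable all_field.
From mathcomp.real_closed Require Import complex.
From mathcomp Require Import reals.

Set Implicit Arguments.
Unset Strict Implicit.
Unset Printing Implicit Defensive.

Import Order.TTheory GRing.Theory Num.Theory.
Local Open Scope ring_scope.

(* [{ffun gT -> _}] already carries the pointwise product; this alias carries  *)
(* the convolution product instead.                                           *)
Definition grpalg (C : numClosedFieldType) (gT : finGroupType) : Type :=
  {ffun gT -> C^o}.

Section GroupAlgebra.
Variables (C : numClosedFieldType) (gT : finGroupType).
Local Notation A := (grpalg C gT).

HB.instance Definition _ := Vector.copy A {ffun gT -> C^o}.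

Definition lam (g : gT) : A := [ffun h => (h == g)%:R].

Definition ga_mul (x y : A) : A :=
  [ffun g => \sum_(h : gT) x h * y (h^-1 * g)%g].

Fact ga_mulA : associative ga_mul.
Proof.
move=> x y z; apply/ffunP=> g; rewrite !ffunE.
under eq_bigr do rewrite ffunE big_distrr /=.
under [RHS]eq_bigr do rewrite ffunE big_distrl /=.
rewrite [RHS]exchange_big /=; apply: eq_bigr => h _.
rewrite [RHS](reindex_inj (mulgI h)) /=; apply: eq_bigr => k _.
by rewrite mulrA mulKg invMg mulgA.
Qed.

Fact ga_mul1l : left_id (lam 1%g) ga_mul.
Proof.
move=> x; apply/ffunP=> g; rewrite ffunE (bigD1 1%g) //= big1 ?addr0.
  by rewrite ffunE eqxx mul1r invg1 mul1g.
by move=> h /negPf h1; rewrite ffunE h1 mul0r.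
Qed.

Fact ga_mul1r : right_id (lam 1%g) ga_mul.
Proof.
move=> x; apply/ffunP=> g; rewrite ffunE (bigD1 g) //= big1 ?addr0.
  by rewrite ffunE mulVg eqxx mulr1.
move=> h /negPf hg; rewrite ffunE -(inj_eq (mulgI h)) mulKVg mulg1 eq_sym hg.
by rewrite mulr0.
Qed.

Fact ga_mulDl : left_distributive ga_mul +%R.
Proof.
move=> x y z; apply/ffunP=> g; rewrite !ffunE -big_split.
by apply: eq_bigr => h _; rewrite ffunE mulrDl.
Qed.

Fact ga_mulDr : right_distributive ga_mul +%R.
Proof.
move=> x y z; apply/ffunP=> g; rewrite !ffunE -big_split.
by apply: eq_bigr => h _; rewrite ffunE mulrDr.
Qed.

Fact ga_1neq0 : lam 1%g != 0.
Proof. by apply/eqP=> /ffunP/(_ 1%g)/eqP; rewrite !ffunE eqxx oner_eq0. Qed.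

HB.instance Definition _ := GRing.Zmodule_isNzRing.Build A
  ga_mulA ga_mul1l ga_mul1r ga_mulDl ga_mulDr ga_1neq0.

Fact ga_scaleAl (c : C) (x y : A) : c *: (x * y) = (c *: x) * y.
Proof.
apply/ffunP=> g; rewrite !ffunE scaler_sumr.
by apply: eq_bigr => h _; rewrite ffunE scalerAl.
Qed.
HB.instance Definition _ := GRing.Lmodule_isLalgebra.Build C A ga_scaleAl.

Fact ga_scaleAr (c : C) (x y : A) : c *: (x * y) = x * (c *: y).
Proof.
apply/ffunP=> g; rewrite !ffunE scaler_sumr.
by apply: eq_bigr => h _; rewrite ffunE scalerAr.
Qed.
HB.instance Definition _ := GRing.Lalgebra_isAlgebra.Build C A ga_scaleAr.

Definition star (x : A) : A := [ffun g => (x g^-1%g)^*].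

Definition counit (x : A) : C := \sum_(g : gT) x g.

End GroupAlgebra.

Arguments lam {C gT} g.

Lemma lamM (C : numClosedFieldType) (gT : finGroupType) (g h : gT) :
  lam g * lam h = lam (g * h)%g :> grpalg C gT.
Proof.
apply/ffunP=> k; rewrite ffunE (bigD1 g) //= big1 => [|i /negPf ig].
  rewrite addr0 !ffunE eqxx mul1r.
  by rewrite -(inj_eq (mulgI g)) mulKVg.
by rewrite ffunE ig mul0r.
Qed.

Section Coideals.
Variables (C : numClosedFieldType) (gT : finGroupType).
Local Notation A := (grpalg C gT).
(* A (x) A is realised as the group algebra of gT * gT, with                  *)
(* lam g (x) lam h identified with lam (g, h) (tens_lam, tensM).              *)
Local Notation AA := (grpalg C (gT * gT)%type).

Definition tens (x y : A) : AA := [ffun p => x p.1 * y p.2].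

Lemma tens_lam (g h : gT) : tens (lam g) (lam h) = lam (g, h).
Proof. by apply/ffunP=> -[k l]; rewrite !ffunE xpair_eqE -natrM mulnb. Qed.

Lemma tensM (x y z t : A) : tens x y * tens z t = tens (x * z) (y * t).
Proof.
apply/ffunP=> -[g h]; rewrite !ffunE /= big_distrl /=.
under [RHS]eq_bigr do rewrite big_distrr /=.
rewrite pair_big /=; apply: eq_bigr => -[k l] _; rewrite !ffunE /=.
by rewrite mulrACA.
Qed.

Definition tensv (U V : {vspace A}) : {vspace AA} :=
  <<[seq tens u v | u <- vbasis U, v <- vbasis V]>>%VS.

(* Unital *-subalgebra I with Delta(I) included in A (x) I.                   *)
Definition coideal_subalgebra (Delta : A -> AA) (I : {vspace A}) : Prop :=
  [/\ 1 \in I,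
      {in I &, forall x y, x * y \in I},
      {in I, forall x, star x \in I}
    & {in I, forall x, Delta x \in tensv fullv I}].

Definition jones_projection (I : {vspace A}) : A -> Prop :=
  unique (fun p : A =>
    [/\ p \in I, p != 0, p * p = p, star p = p
      & {in I, forall y, y * p = counit y *: p}]).

Definition subgroup_projection (L : {set gT}) : A :=
  #|L|%:R^-1 *: \sum_(g in L) lam g.

Definition realized_by_coideal (Delta : A -> AA) (L : {set gT}) : Prop :=
  exists I : {vspace A},
    [/\ coideal_subalgebra Delta I,
        jones_projection I (subgroup_projection L),
        \dim I = #|L|
      & abelian L -> {in I &, commutative *%R}].

End Coideals.

Section KD.

(* Together with #|gT| = 4n, this says that (a, b) realises the presentation  *)
(* <a, b | a^2n = b^2 = 1, b a = a^-1 b>.                                     *)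
Definition dihedral_generators (gT : finGroupType) (n : nat) (a b : gT) :=
  [/\ <<[set a; b]>> = [set: gT], a ^+ (2 * n) = 1, b ^+ 2 = 1
    & b * a = a^-1 * b]%g.

Lemma dihedral_generators_exist (n : nat) :
  (0 < n)%N -> exists a b : 'D_(4 * n), dihedral_generators n a b.
Proof.
move=> n_gt0.
have q_gt1 : (1 < 2 * n)%N by rewrite mul2n -addnn -(prednK n_gt0) addnS addSn.
have defm : (4 * n = (2 * n).*2)%N by rewrite -mul2n mulnA.
have /isoGrp_hom := Grp_dihedral q_gt1; rewrite defm.
case/existsP=> -[a b] /=.
case/eqP=> gen aq b2 ab; exists a, b; split=> //.
  by rewrite -gen joing_idl joing_idr.
have bV : (b^-1 = b)%g by apply/eqP; rewrite eq_invg_mul -b2 expgS expg1.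
by rewrite -ab conjgE bV -!mulgA -[(b * b)%g]/(b ^+ 2)%g b2 mulg1.
Qed.

Variables (C : numClosedFieldType) (gT : finGroupType) (n : nat) (a b : gT).

Definition KD_h (i : 'I_4) : gT :=
  tnth [tuple 1; a ^+ n; b; b * a ^+ n]%g i.

Definition KD_nu : C := -1 + 2 * 'i.

Definition KD_coef : 'M[C]_4 :=
  8^-1 *: \matrix_(i < 4, j < 4)
    nth 0 (nth [::]
      [:: [:: 5; 1; 1; 1];
          [:: 1; 1; KD_nu^*; KD_nu];
          [:: 1; KD_nu; 1; KD_nu^*];
          [:: 1; KD_nu^*; KD_nu; 1]] i) j.

Definition KD_Omega : grpalg C (gT * gT)%type :=
  \sum_(i < 4) \sum_(j < 4) KD_coef i j *: tens (lam (KD_h i)) (lam (KD_h j)).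

Definition Delta_s (x : grpalg C gT) : grpalg C (gT * gT)%type :=
  \sum_(g : gT) x g *: tens (lam g) (lam g).

Definition KD_Delta (x : grpalg C gT) : grpalg C (gT * gT)%type :=
  KD_Omega * Delta_s x * star KD_Omega.

Definition KD_H (r : nat) : {set gT} :=
  [set 1; a ^+ n; b * a ^+ r; b * a ^+ (r + n)]%g.

Definition KD_A (k : nat) : {set gT} := <[a ^+ k]>%g.

Definition KD_B (k : nat) : {set gT} := <<[set a ^+ k; b]>>%g.

End KD.

Arguments KD_Delta C {gT}.

(* Main.v *)
Require Import Defs.
From HB Require Import structures.
From mathcomp Require Import all_boot all_order all_algebra.
From mathcomp Require Import all_fingroup all_solvable all_field.
From mathcomp.real_closed Require Import complex.
From mathcomp Require Import reals ring.
Local Open Scope ring_scope.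

Set Implicit Arguments.
Unset Strict Implicit.
Unset Printing Implicit Defensive.

Import Order.TTheory GRing.Theory Num.Theory.

(** Write z = a^n and H = {1, z, b, bz}, and let (x) denote the tensor product.
    Replacing Omega by a gauge-equivalent twist
      Omega_w = (w* (x) w* ) Omega Delta_s(w),   w a unitary of C[H],
    changes the coproduct only by conjugation by w: the coideal subalgebras for
    Omega are the conjugates w I w* of the coideal subalgebras I for Omega_w.
    So a subgroup L is settled once there is a w such that C[L] itself is a
    coideal subalgebra for Omega_w and w commutes with the projection p_L of L:
    then I = w C[L] w* has dimension |L|, is commutative when L is, and has
    Jones projection w p_L w* = p_L (twist_realizes).

    On the characters of H the matrix of Omega is 1 whenever one of the two
    characters is trivial or both are equal, and i or -i otherwise. Let e be the
    minimal projection of C[H] at the character with z, b |-> -1, and put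
    v = 1 + (i - 1) e, a unitary. Then w = v gives the twist
      F = (1 + z)/2 (x) 1 + (1 - z)/2 (x) b,
    and w = v* gives the twist
      F' = (1 + b)/2 (x) 1 + (1 - b)/2 (x) z
    (Omega_gauge and Omega_star_gauge).

    The twist F preserves C[L] as soon as b normalizes L and z centralizes
    it: the terms of F (g (x) g) F* mixing (1 + z)/2 and (1 - z)/2
    vanish, and the others have right legs g and b g b. Moreover v, being in
    C[H], commutes with p_L. This covers A_k and B_k (realized_of_normalizer).

    The twist F' preserves C[L] as soon as z is in L, since its right legs are
    1 and z. Moreover z e = - e and z p_L = p_L force e p_L = 0, whence
    v p_L = p_L. This covers H_r, which b need not normalize
    (realized_of_mem). *)

(** * The *-algebra C[G] and the coproduct Delta_s *)

Section GroupAlgebra.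
Variables (C : numClosedFieldType) (gT : finGroupType).
Local Notation A := (grpalg C gT).
Implicit Types (x y : A) (g h : gT).

Lemma lam_expansion x : x = \sum_g x g *: lam g.
Proof.
apply/ffunP=> g; rewrite sum_ffunE (bigD1 g) //= big1 => [|h /negPf hg].
  by rewrite !ffunE eqxx [_ *: _]mulr1 addr0.
by rewrite !ffunE eq_sym hg scaler0.
Qed.

Lemma lam1 : lam 1%g = 1 :> A.
Proof. by []. Qed.

Lemma star_lam g : star (lam g) = lam g^-1%g :> A.
Proof.
by apply/ffunP=> h; rewrite !ffunE conjC_nat -(inj_eq invg_inj) invgK.
Qed.

Lemma starD x y : star (x + y) = star x + star y.
Proof. by apply/ffunP=> g; rewrite !ffunE rmorphD. Qed.

Lemma starZ (c : C) x : star (c *: x) = c^* *: star x.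
Proof. by apply/ffunP=> g; rewrite !ffunE rmorphM. Qed.

Lemma star0 : star (0 : A) = 0.
Proof. by apply/ffunP=> g; rewrite !ffunE rmorph0. Qed.

Lemma starN x : star (- x) = - star x.
Proof. by rewrite -scaleN1r starZ rmorphN1 scaleN1r. Qed.

Lemma star_sum I (r : seq I) (P : pred I) (F : I -> A) :
  star (\sum_(i <- r | P i) F i) = \sum_(i <- r | P i) star (F i).
Proof. exact: (big_morph _ starD star0). Qed.

Lemma starK x : star (star x) = x.
Proof. by apply/ffunP=> g; rewrite !ffunE invgK conjCK. Qed.

Lemma starM x y : star (x * y) = star y * star x.
Proof.
apply/ffunP=> g; rewrite !ffunE rmorph_sum /=.
rewrite (reindex_inj (mulgI g^-1%g)) /=; apply: eq_bigr => h _.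
by rewrite !ffunE rmorphM /= mulrC !invMg !invgK -mulgA mulgV mulg1.
Qed.

Lemma star1 : star (1 : A) = 1.
Proof. by rewrite -lam1 star_lam invg1. Qed.

Fact counit_is_linear : linear_for *%R (@counit C gT).
Proof.
move=> c x y.
by rewrite /counit big_distrr -big_split; apply: eq_bigr => g _; rewrite !ffunE.
Qed.
HB.instance Definition _ :=
  GRing.isLinear.Build C A C *%R (@counit C gT) counit_is_linear.

Lemma counit_lam g : counit (lam g : A) = 1.
Proof.
rewrite /counit (bigD1 g) //= big1 ?ffunE ?eqxx ?addr0 // => h /negPf hg.
by rewrite ffunE hg.
Qed.

Lemma counitM x y : counit (x * y) = counit x * counit y.
Proof.
rewrite {1}[x]lam_expansion {1}[y]lam_expansion mulr_suml linear_sum /=.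
rewrite {2}/counit big_distrl /=; apply: eq_bigr => g _.
rewrite mulr_sumr linear_sum big_distrr /=; apply: eq_bigr => h _.
by rewrite -scalerAl -scalerAr lamM !linearZ /= counit_lam mulr1.
Qed.

Lemma counit1 : counit (1 : A) = 1.
Proof. exact: counit_lam. Qed.

Lemma lamZM (c d : C) g h :
  (c *: lam g) * (d *: lam h) = (c * d) *: lam (g * h)%g :> A.
Proof. by rewrite -scalerAl -scalerAr lamM scalerA. Qed.

Definition sandwich (u v x : A) : A := u * x * v.

Fact sandwich_is_linear u v : linear (sandwich u v).
Proof.
by move=> c x y; rewrite /sandwich mulrDr mulrDl -scalerAr -scalerAl.
Qed.
HB.instance Definition _ u v :=
  GRing.isLinear.Build C A A *:%R (sandwich u v) (sandwich_is_linear u v).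

End GroupAlgebra.

Section Tensor.
Variables (C : numClosedFieldType) (gT : finGroupType).
Local Notation A := (grpalg C gT).
Local Notation AA := (grpalg C (gT * gT)%type).
Implicit Types (x y : A) (X : AA) (g h : gT).

Fact tens_is_bilinear : bilinear_for *:%R *:%R (@tens C gT).
Proof.
by split=> z c x y; apply/ffunP=> p; rewrite !ffunE;
  [rewrite mulrDl -scalerAl | rewrite mulrDr -scalerAr].
Qed.
HB.instance Definition _ :=
  bilinear_isBilinear.Build C A A AA *:%R *:%R (@tens C gT) tens_is_bilinear.

Lemma star_tens x y : star (tens x y) = tens (star x) (star y).
Proof. by apply/ffunP=> -[g h]; rewrite !ffunE rmorphM. Qed.

Lemma mem_tensv (U V : {vspace A}) x y :
  x \in U -> y \in V -> tens x y \in tensv U V.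
Proof.
move=> /coord_vbasis-> /coord_vbasis->.
rewrite linear_sumlz; apply: memv_suml => i _.
rewrite linear_sumr; apply: memv_suml => j _.
rewrite linearZl_LR linearZr_LR /=; do 2! apply: memvZ.
by apply/memv_span/allpairsP; exists ((vbasis U)`_i, (vbasis V)`_j);
  rewrite !mem_nth ?size_tuple.
Qed.

Fact Delta_s_is_linear : linear (@Delta_s C gT).
Proof.
move=> c x y; rewrite /Delta_s scaler_sumr -big_split; apply: eq_bigr => g _.
by rewrite !ffunE scalerDl scalerA.
Qed.
HB.instance Definition _ :=
  GRing.isLinear.Build C A AA *:%R (@Delta_s C gT) Delta_s_is_linear.

Lemma Delta_s_lam g : Delta_s (lam g) = lam (g, g) :> AA.
Proof.
rewrite /Delta_s (bigD1 g) //= big1 => [|h /negPf hg]; last first.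
  by rewrite ffunE hg scale0r.
by rewrite ffunE eqxx scale1r addr0 tens_lam.
Qed.

Lemma Delta_sM x y : Delta_s (x * y) = Delta_s x * Delta_s y.
Proof.
rewrite {1}[x]lam_expansion {1}[y]lam_expansion mulr_suml linear_sum /=.
rewrite {2}/Delta_s mulr_suml; apply: eq_bigr => g _.
rewrite mulr_sumr linear_sum mulr_sumr; apply: eq_bigr => h _.
by rewrite !tens_lam !lamZM linearZ /= Delta_s_lam.
Qed.

Lemma Delta_s_star x : Delta_s (star x) = star (Delta_s x).
Proof.
rewrite {1}[x]lam_expansion star_sum linear_sum star_sum.
apply: eq_bigr => g _.
by rewrite !starZ linearZ /= star_lam Delta_s_lam tens_lam star_lam.
Qed.

End Tensor.

(** * Subalgebras C[L] and subgroup projections *)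

Section SubgroupAlgebra.
Variables (C : numClosedFieldType) (gT : finGroupType).
Local Notation A := (grpalg C gT).
Implicit Types (x y : A) (g h : gT).

Definition subgroup_algebra (L : {set gT}) : {vspace A} :=
  <<[seq lam g | g in L]>>%VS.

Lemma mem_subgroup_algebra (L : {set gT}) g :
  g \in L -> lam g \in subgroup_algebra L.
Proof. by move=> Lg; apply/memv_span/map_f; rewrite mem_enum. Qed.

Lemma subgroup_algebra_expansion (L : {set gT}) x :
  x \in subgroup_algebra L -> x = \sum_(g in L) x g *: lam g.
Proof.
rewrite -[subgroup_algebra L]/(<<map_tuple lam (enum_tuple L)>>%VS) => Lx.
rewrite {1}[x]lam_expansion (bigID (mem L)) /=.
rewrite [X in _ + X]big1 ?addr0 // => g L'g.
suff -> : x g = 0 by rewrite scale0r.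
rewrite (coord_span Lx) sum_ffunE big1 // => i _.
rewrite -tnth_nth tnth_map !ffunE; case: eqP => [gi|]; last by rewrite scaler0.
by case/negP: L'g; rewrite gi -mem_enum; apply: mem_tnth.
Qed.

Lemma lam_free (L : {set gT}) : free [seq (lam g : A) | g in L].
Proof.
have: free (map_tuple lam (enum_tuple L) : #|L|.-tuple A); last by [].
apply/freeP=> k k0 i; have /ffunP/(_ (tnth (enum_tuple L) i)) := k0.
rewrite ffunE sum_ffunE (bigD1 i) //= big1 => [|j /negPf ji].
  by rewrite addr0 -tnth_nth tnth_map !ffunE eqxx [_ *: _]mulr1.
rewrite -tnth_nth tnth_map !ffunE (inj_eq _) ?[_ == j]eq_sym ?ji ?scaler0 //.
by apply/tuple_uniqP; apply: enum_uniq.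
Qed.

Lemma dim_subgroup_algebra (L : {set gT}) : \dim (subgroup_algebra L) = #|L|.
Proof. by rewrite (eqP (lam_free L)) size_image. Qed.

Lemma subgroup_algebraM (G : {group gT}) :
  {in subgroup_algebra G &, forall x y, x * y \in subgroup_algebra G}.
Proof.
move=> x y /subgroup_algebra_expansion-> /subgroup_algebra_expansion->.
rewrite mulr_suml memv_suml // => g Gg; rewrite mulr_sumr memv_suml // => h Gh.
by rewrite lamZM memvZ // mem_subgroup_algebra ?groupM.
Qed.

Lemma subgroup_algebra_star (G : {group gT}) :
  {in subgroup_algebra G, forall x, star x \in subgroup_algebra G}.
Proof.
move=> x /subgroup_algebra_expansion->; rewrite star_sum memv_suml // => g Gg.
by rewrite starZ star_lam memvZ // mem_subgroup_algebra ?groupV.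
Qed.

Lemma subgroup_algebraC (L : {set gT}) :
  abelian L -> {in subgroup_algebra L &, commutative *%R}.
Proof.
move=> /centsP cLL x y.
move=> /subgroup_algebra_expansion-> /subgroup_algebra_expansion->.
rewrite mulr_suml [RHS]mulr_sumr; apply: eq_bigr => g Lg.
rewrite mulr_sumr [RHS]mulr_suml; apply: eq_bigr => h Lh.
by rewrite !lamZM mulrC (cLL g Lg h Lh).
Qed.

Lemma lam_mul_projection (G : {group gT}) g :
  g \in G -> lam g * subgroup_projection C G = subgroup_projection C G.
Proof.
move=> Gg; rewrite /subgroup_projection -scalerAr mulr_sumr; congr (_ *: _).
rewrite [RHS](reindex_inj (mulgI g)) /=; apply: eq_big => h.
  by rewrite groupMl.
by rewrite lamM.
Qed.

Lemma star_projection (G : {group gT}) :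
  star (subgroup_projection C G) = subgroup_projection C G.
Proof.
rewrite /subgroup_projection starZ fmorphV /= conjC_nat star_sum.
rewrite [in RHS](reindex_inj invg_inj) /=; congr (_ *: _).
by apply: eq_big => [g|g _]; rewrite ?groupV ?star_lam.
Qed.

Lemma counit_projection (G : {group gT}) : counit (subgroup_projection C G) = 1.
Proof.
rewrite linearZ linear_sum /=; under eq_bigr do rewrite counit_lam.
by rewrite sumr_const mulVf // pnatr_eq0 -lt0n cardG_gt0.
Qed.

Lemma mem_projection (L : {set gT}) :
  subgroup_projection C L \in subgroup_algebra L.
Proof.
by rewrite memvZ // memv_suml // => g Lg; apply: mem_subgroup_algebra.
Qed.

Lemma subgroup_algebra_mul_projection (G : {group gT}) :
  {in subgroup_algebra G, forall x,
     x * subgroup_projection C G = counit x *: subgroup_projection C G}.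
Proof.
move=> x /subgroup_algebra_expansion->.
rewrite mulr_suml linear_sum scaler_suml /=; apply: eq_bigr => g Gg.
rewrite -scalerAl lam_mul_projection //.
by rewrite [counit _]linearZ /= counit_lam mulr1.
Qed.

Lemma projection_norm (L : {set gT}) h : h \in 'N(L)%g ->
  lam h * subgroup_projection C L = subgroup_projection C L * lam h.
Proof.
move=> nLh; rewrite /subgroup_projection -scalerAr -scalerAl.
rewrite mulr_sumr mulr_suml; congr (_ *: _).
rewrite (reindex_inj (conjg_inj h)) /=; apply: eq_big => [g|g _].
  by rewrite memJ_norm.
by rewrite !lamM conjgE mulKVg.
Qed.

(** A second projection q with the same properties satisfies q p = p and
    p q = q; taking adjoints in the first equation gives p = q. *)
Lemma jones_projection_intro (I : {vspace A}) p :
  p \in I -> star p = p -> counit p = 1 ->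
  {in I, forall y, y * p = counit y *: p} -> jones_projection I p.
Proof.
move=> Ip pS p1 epsP; split=> [|q [Iq q0 qq qS epsQ]].
  split=> //; last by rewrite epsP // p1 scale1r.
  by apply: contra_eq_neq p1 => ->; rewrite linear0 eq_sym oner_eq0.
have eps_q : counit q = 1.
  apply/eqP; rewrite -subr_eq0; apply/eqP/(mulIf (oner_neq0 _)).
  have /eqP := epsQ q Iq; rewrite qq -subr_eq0 -{1}[q]scale1r -scalerBl.
  rewrite scaler_eq0 (negPf q0) orbF subr_eq0 => /eqP<-.
  by rewrite subrr !mul0r.
have qp : q * p = p by rewrite epsP // eps_q scale1r.
by rewrite -pS -qp starM pS qS epsQ // p1 scale1r.
Qed.

End SubgroupAlgebra.

(** * Coideal subalgebras from gauge-equivalent twists *)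

Section TwistRealizes.
Variables (C : numClosedFieldType) (gT : finGroupType).
Local Notation A := (grpalg C gT).
Local Notation AA := (grpalg C (gT * gT)%type).

Lemma tensv_sandwich (U V : {vspace A}) (w : A) (X : AA) :
  {in U, forall u, w * u * star w \in V} ->
  X \in tensv fullv U ->
  tens w w * X * star (tens w w) \in tensv fullv V.
Proof.
move=> UV UX; pose f := linfun (sandwich (tens w w) (star (tens w w))).
have fE Y : f Y = tens w w * Y * star (tens w w) by rewrite lfunE.
rewrite -fE memv_preim; apply: subvP X UX; apply/span_subvP => _
  /allpairsP[[x y] [_ /vbasis_mem Uy ->]] /=.
rewrite -memv_preim fE star_tens !tensM mem_tensv ?memvf //.
exact: UV.
Qed.

(** Since w transports Omega to F, it transports the coideal subalgebra C[G] for
    the coproduct twisted by F to the coideal subalgebra w C[G] w* for Omega. *)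
Lemma twist_realizes (Omega F : AA) (w : A) (G : {group gT}) :
  w * star w = 1 -> star w * w = 1 ->
  Omega * Delta_s w = tens w w * F ->
  w * subgroup_projection C G * star w = subgroup_projection C G ->
  {in G, forall g,
     F * lam (g, g) * star F \in tensv fullv (subgroup_algebra C G)} ->
  realized_by_coideal (fun x => Omega * Delta_s x * star Omega) G.
Proof.
move=> wwS wSw OmegaF wp FG.
pose f := linfun (sandwich w (star w)).
have fE x : f x = w * x * star w by rewrite lfunE.
have fM x y : f x * f y = f (x * y).
  by rewrite !fE !mulrA -(mulrA _ (star w)) wSw mulr1.
have counit_f x : counit (f x) = counit x.
  by rewrite fE !counitM mulrAC -counitM wwS counit1 mul1r.
have fp : f (subgroup_projection C G) = subgroup_projection C G by rewrite fE.
pose I := (f @: subgroup_algebra C G)%VS.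
have Ip : subgroup_projection C G \in I by rewrite -fp memv_img ?mem_projection.
exists I; split.
- split.
  + have -> : 1 = f 1 by rewrite fE mulr1.
    by rewrite memv_img // -lam1 mem_subgroup_algebra.
  + move=> _ _ /memv_imgP[x Gx ->] /memv_imgP[y Gy ->].
    by rewrite fM memv_img ?subgroup_algebraM.
  + move=> _ /memv_imgP[x Gx ->].
    suff -> : star (f x) = f (star x).
      by rewrite memv_img ?subgroup_algebra_star.
    by rewrite !fE !starM starK mulrA.
  + move=> _ /memv_imgP[x Gx ->].
    have -> : Omega * Delta_s (f x) * star Omega =
        tens w w * (F * Delta_s x * star F) * star (tens w w).
      rewrite fE !Delta_sM Delta_s_star !mulrA OmegaF -!mulrA -starM.
      by rewrite -starM OmegaF starM !mulrA.
    apply: tensv_sandwich (_ : _ \in tensv _ (subgroup_algebra C G)).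
      by move=> u Gu; rewrite -fE memv_img.
    rewrite (subgroup_algebra_expansion Gx) linear_sum mulr_sumr mulr_suml.
    apply: memv_suml => g Gg; rewrite linearZ /= Delta_s_lam.
    by rewrite -scalerAr -scalerAl memvZ ?FG.
- apply: jones_projection_intro => //.
  + exact: star_projection.
  + exact: counit_projection.
  + move=> _ /memv_imgP[x Gx ->]; rewrite -{1}fp fM counit_f.
    by rewrite subgroup_algebra_mul_projection // linearZ /= fp.
- rewrite limg_dim_eq ?dim_subgroup_algebra //; apply/eqP; rewrite -subv0.
  apply: subv_trans (capvSr _ _) _; apply/subvP => x.
  rewrite memv_ker memv0 fE => /eqP fx0.
  have -> : x = star w * (w * x * star w) * w.
    by rewrite !mulrA wSw mul1r -mulrA wSw mulr1.
  by rewrite fx0 mulr0 mul0r.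
- move=> cGG _ _ /memv_imgP[x Gx ->] /memv_imgP[y Gy ->].
  by rewrite !fM (subgroup_algebraC cGG).
Qed.

End TwistRealizes.

(** * Convolution calculus in the group algebra of a Klein four-group *)

Section Klein.
Variables (C : numClosedFieldType) (gT : finGroupType) (z b : gT).
Hypotheses (zz : (z * z = 1)%g) (bb : (b * b = 1)%g) (zb : (z * b = b * z)%g).
Local Notation A := (grpalg C gT).
Local Notation AA := (grpalg C (gT * gT)%type).
Local Notation V := (bool * bool)%type.

Definition xorV (s t : V) : V := (s.1 (+) t.1, s.2 (+) t.2).

Lemma xorVK t : involutive (xorV^~ t).
Proof. by case: t => [[] []] [[] []]. Qed.

(** Indexing by exponents turns products into sums of indices, so that
    identities in the group algebra reduce to identities of coefficients. *)
Definition klein (u : V) : gT := (b ^+ u.1 * z ^+ u.2)%g.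

Lemma kleinM u w : (klein u * klein w = klein (xorV u w))%g.
Proof.
have zb_comm (i j : bool) : (z ^+ i * b ^+ j = b ^+ j * z ^+ i)%g.
  exact: commuteX2.
have addb_exp (x : gT) (i j : bool) :
    (x * x = 1 -> x ^+ i * x ^+ j = x ^+ (i (+) j))%g.
  by move: i j => [] [] xx; rewrite ?mulg1 ?mul1g.
rewrite /klein -mulgA (mulgA (z ^+ _)%g) zb_comm -mulgA (addb_exp z) //.
by rewrite mulgA addb_exp.
Qed.

Lemma kleinV u : (klein u)^-1%g = klein u.
Proof.
by apply/eqP; rewrite eq_invg_mul kleinM /klein /= !addbb mulg1.
Qed.

Definition klein_sum (c : V -> C) : A := \sum_u c u *: lam (klein u).

Definition klein_sum2 (c : V -> V -> C) : AA :=
  \sum_u \sum_w c u w *: lam (klein u, klein w).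

Lemma klein_sum_lam c t :
  klein_sum c * lam (klein t) = klein_sum (fun u => c (xorV u t)).
Proof.
rewrite /klein_sum mulr_suml [LHS](reindex_inj (inv_inj (xorVK t))) /=.
by apply: eq_bigr => u _; rewrite -scalerAl lamM kleinM xorVK.
Qed.

Lemma klein_sum2_lam c s t : klein_sum2 c * lam (klein s, klein t) =
  klein_sum2 (fun u w => c (xorV u s) (xorV w t)).
Proof.
rewrite /klein_sum2 mulr_suml [LHS](reindex_inj (inv_inj (xorVK s))) /=.
apply: eq_bigr => u _.
rewrite mulr_suml [LHS](reindex_inj (inv_inj (xorVK t))) /=.
apply: eq_bigr => w _; rewrite -scalerAl lamM.
by rewrite -[(_ * _)%g]/((_ * _)%g, (_ * _)%g) !kleinM !xorVK.
Qed.

Lemma klein_sumM c d : klein_sum c * klein_sum d =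
  klein_sum (fun u => \sum_t d t * c (xorV u t)).
Proof.
rewrite [klein_sum d]/klein_sum mulr_sumr.
under eq_bigr do rewrite -scalerAr klein_sum_lam scaler_sumr.
rewrite exchange_big; apply: eq_bigr => u _.
by rewrite scaler_suml; apply: eq_bigr => t _; rewrite scalerA.
Qed.

Lemma star_klein_sum c : star (klein_sum c) = klein_sum (fun u => (c u)^*).
Proof.
by rewrite star_sum; apply: eq_bigr => u _; rewrite starZ star_lam kleinV.
Qed.

Lemma klein_sum2_Delta_s c d : klein_sum2 c * Delta_s (klein_sum d) =
  klein_sum2 (fun u w => \sum_t d t * c (xorV u t) (xorV w t)).
Proof.
rewrite [klein_sum d]/klein_sum linear_sum mulr_sumr /=.
under eq_bigr => t _.
  rewrite linearZ /= Delta_s_lam -scalerAr klein_sum2_lam scaler_sumr.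
  under eq_bigr do rewrite scaler_sumr.
  over.
rewrite exchange_big; apply: eq_bigr => u _.
rewrite exchange_big; apply: eq_bigr => w _.
by rewrite scaler_suml; apply: eq_bigr => t _; rewrite scalerA.
Qed.

Lemma tens_klein_sum c d :
  tens (klein_sum c) (klein_sum d) = klein_sum2 (fun u w => c u * d w).
Proof.
rewrite linear_sumlz; apply: eq_bigr => u _.
rewrite linear_sumr; apply: eq_bigr => w _.
by rewrite linearZl_LR linearZr_LR /= tens_lam scalerA.
Qed.

(** For involutions s, t this is the unitary acting on the right leg as 1 where
    s is 1 on the left leg, and as t where s is -1. *)
Definition involution_twist (s t : gT) : AA :=
  tens (2^-1 *: (1 + lam s)) 1 + tens (2^-1 *: (1 - lam s)) (lam t).

Lemma klein_sum2_twist c s t :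
  klein_sum2 c * involution_twist (klein s) (klein t) =
  klein_sum2 (fun u w => 2^-1 * (c u w + c (xorV u s) w +
                          c u (xorV w t) - c (xorV u s) (xorV w t))).
Proof.
pose o : V := (false, false).
have xor0 u : xorV u o = u by case: u => [[] []].
have -> : involution_twist (klein s) (klein t) =
    2^-1 *: (lam (klein o, klein o) + lam (klein s, klein o) +
    lam (klein o, klein t) - lam (klein s, klein t)).
  have k0 : klein o = 1%g by rewrite /klein mulg1.
  rewrite -!tens_lam k0 !lam1 /involution_twist !linearZl_LR.
  by rewrite linearDl linearBl /= -scalerDr addrA.
rewrite -scalerAr mulrBr !mulrDr !klein_sum2_lam scalerBr !scalerDr.
rewrite !scaler_sumr -!big_split -sumrB; apply: eq_bigr => u _.
rewrite !scaler_sumr -!big_split -sumrB; apply: eq_bigr => w _.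
by rewrite /= -!scalerDr -scalerBr -!scalerDl -scalerBl scalerA !xor0.
Qed.

End Klein.

(** * The gauge transformations of Omega *)

Section Gauge.
Variables (C : numClosedFieldType) (gT : finGroupType) (n : nat) (a b : gT).
Local Notation z := (a ^+ n)%g.
Hypotheses (zz : (z * z = 1)%g) (bb : (b * b = 1)%g) (zb : (z * b = b * z)%g).
Local Notation A := (grpalg C gT).
Local Notation AA := (grpalg C (gT * gT)%type).
Local Notation V := (bool * bool)%type.
Local Notation kl := (klein z b).

(** The rows of KD_coef are numbered in the order 1, z, b, bz. *)
Definition klein_index (u : V) : 'I_4 := inord (2 * u.1 + u.2).

Lemma klein_index_bij : bijective klein_index.
Proof.
apply: inj_card_bij; last by rewrite card_prod card_bool card_ord.
move=> [[] []] [[] []] //= /(congr1 (@nat_of_ord 4));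
  by rewrite /= !inordK.
Qed.

Lemma KD_OmegaE : KD_Omega C n a b =
  klein_sum2 z b (fun u w => KD_coef C (klein_index u) (klein_index w)).
Proof.
have hE u : KD_h n a b (klein_index u) = kl u.
  rewrite /KD_h (tnth_nth 1%g) inordK; last by case: u => [[] []].
  by rewrite /klein; case: u => [[] []] /=; rewrite ?mulg1 ?mul1g ?expg1.
rewrite /KD_Omega (reindex _ (onW_bij _ klein_index_bij)).
apply: eq_bigr => u _.
rewrite (reindex _ (onW_bij _ klein_index_bij)); apply: eq_bigr => w _.
by rewrite tens_lam !hE.
Qed.

(** The coefficients of 1 + (j - 1) e, where e is the minimal projection of the
    Klein four-group algebra at the character with z, b |-> -1. *)
Definition gauge_coef (j : C) (u : V) : C :=
  (u == (false, false))%:R + (j - 1) / 4 * (-1) ^+ (u.1 (+) u.2).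

Definition gauge (j : C) : A := klein_sum z b (gauge_coef j).

Lemma sum_V (M : nmodType) (F : V -> M) : \sum_t F t =
  F (true, true) + F (true, false) + (F (false, true) + F (false, false)).
Proof.
rewrite (eq_bigr (fun t => F (t.1, t.2))) => [|[] //].
by rewrite -(pair_bigA _ (fun i j => F (i, j))) /= !big_bool.
Qed.

Lemma eq_klein_sum2 (c d : V -> V -> C) :
  (forall u w, c u w = d u w) -> klein_sum2 z b c = klein_sum2 z b d.
Proof. by move=> cd; do 2![apply: eq_bigr => ? _]; rewrite cd. Qed.

Lemma star_gauge : star (gauge 'i) = gauge (- 'i).
Proof.
rewrite star_klein_sum //; apply: eq_bigr => u _; congr (_ *: _).
rewrite /gauge_coef rmorphD rmorphM fmorph_div rmorphB rmorph1 rmorph_sign /=.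
by rewrite !rmorph_nat conjCi.
Qed.

(** By star_gauge, for j = 'i this is the unitarity of gauge 'i. *)
Lemma gauge_unitary (j : C) : j * j = -1 -> gauge j * gauge (- j) = 1.
Proof.
move=> jj; rewrite klein_sumM // /klein_sum (bigD1 (false, false)) //=.
rewrite [X in _ + X]big1 => [|u]; rewrite sum_V /gauge_coef /xorV.
  rewrite addr0 [klein _ _ _]mulg1 lam1 -[RHS]scale1r /=; congr (_ *: _).
  by field: jj.
move=> u0; rewrite -[RHS](scale0r (lam (kl u))); congr (_ *: _).
by case: u u0 => [[] []] //= _; field: jj.
Qed.

Let ii : 'i * 'i = -1 :> C. Proof. by rewrite -expr2 sqrCi. Qed.
Let klein_z : z = kl (false, true). Proof. by rewrite /klein mul1g. Qed.
Let klein_b : b = kl (true, false). Proof. by rewrite /klein mulg1. Qed.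

Lemma KD_nu_conj : (KD_nu C)^* = -1 - 2 * 'i.
Proof. by rewrite rmorphD rmorphM rmorphN1 rmorph_nat /= conjCi mulrN. Qed.

Lemma Omega_Delta_gauge (j : C) (s t : V) :
  (forall u w,
    \sum_r gauge_coef j r *
        KD_coef C (klein_index (xorV u r)) (klein_index (xorV w r)) =
    2^-1 * (gauge_coef j u * gauge_coef j w +
            gauge_coef j (xorV u s) * gauge_coef j w +
            gauge_coef j u * gauge_coef j (xorV w t) -
            gauge_coef j (xorV u s) * gauge_coef j (xorV w t))) ->
  KD_Omega C n a b * Delta_s (gauge j) =
  tens (gauge j) (gauge j) * involution_twist C (kl s) (kl t).
Proof.
move=> coefE; rewrite KD_OmegaE klein_sum2_Delta_s // tens_klein_sum.
by rewrite klein_sum2_twist //; apply: eq_klein_sum2.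
Qed.

Lemma Omega_gauge : KD_Omega C n a b * Delta_s (gauge 'i) =
  tens (gauge 'i) (gauge 'i) * involution_twist C z b.
Proof.
have -> : involution_twist C z b =
    involution_twist C (kl (false, true)) (kl (true, false)).
  by rewrite -klein_z -klein_b.
apply: Omega_Delta_gauge => u w; rewrite sum_V !mxE KD_nu_conj /KD_nu.
by case: u w => [[] []] [[] []]; rewrite /gauge_coef /xorV /= !inordK //=;
  field: ii.
Qed.

Lemma Omega_star_gauge : KD_Omega C n a b * Delta_s (gauge (- 'i)) =
  tens (gauge (- 'i)) (gauge (- 'i)) * involution_twist C b z.
Proof.
have -> : involution_twist C b z =
    involution_twist C (kl (true, false)) (kl (false, true)).
  by rewrite -klein_z -klein_b.
apply: Omega_Delta_gauge => u w; rewrite sum_V !mxE KD_nu_conj /KD_nu.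
by case: u w => [[] []] [[] []]; rewrite /gauge_coef /xorV /= !inordK //=;
  field: ii.
Qed.

End Gauge.

(** * Coideal subalgebras of KD(n) with a given subgroup projection *)

Section Realization.
Variables (C : numClosedFieldType) (gT : finGroupType).
Local Notation A := (grpalg C gT).
Local Notation AA := (grpalg C (gT * gT)%type).

Lemma involution_twist_conj (s t g : gT) :
  (s * s = 1)%g -> (t * t = 1)%g ->
  let p : A := 2^-1 *: (1 + lam s) in
  let q : A := 2^-1 *: (1 - lam s) in
  involution_twist C s t * lam (g, g) * star (involution_twist C s t) =
  tens (p * lam g * p) (lam g) + tens (p * lam g * q) (lam (g * t)%g) +
  (tens (q * lam g * p) (lam (t * g)%g)
     + tens (q * lam g * q) (lam (t * g * t)%g)).
Proof.
move=> ss tt p q.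
have lamV (x : gT) : (x * x = 1)%g -> star (lam x) = lam x :> A.
  move=> xx; rewrite star_lam; congr (lam _).
  by apply/eqP; rewrite eq_invg_mul xx.
have half : (2^-1 : C)^* = 2^-1 by rewrite fmorphV rmorph_nat.
have pS : star p = p by rewrite starZ half starD star1 lamV.
have qS : star q = q by rewrite starZ half starD starN star1 lamV.
rewrite /involution_twist -/p -/q starD !star_tens pS qS star1 lamV //.
by rewrite -tens_lam !mulrDl !mulrDr !tensM !mul1r !mulr1 !lamM.
Qed.

Variables (n : nat) (a b : gT).
Local Notation z := (a ^+ n)%g.
Hypotheses (zz : (z * z = 1)%g) (bb : (b * b = 1)%g) (zb : (z * b = b * z)%g).

Let ii : 'i * 'i = -1 :> C. Proof. by rewrite -expr2 sqrCi. Qed.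

Local Notation v := (gauge n a b ('i : C)).
Local Notation vS := (gauge n a b (- 'i : C)).

Let gaugeVK : v * vS = 1.
Proof. exact: gauge_unitary. Qed.
Let gaugeKV : vS * v = 1.
Proof. by rewrite -{2}['i]opprK gauge_unitary // mulrNN. Qed.
Let star_gaugeN : star vS = v.
Proof. by rewrite -star_gauge // starK. Qed.

(** The coideal subalgebra is v C[G] v*, with v = gauge 'i. *)
Lemma realized_of_normalizer (G : {group gT}) :
  b \in 'N(G)%g -> z \in 'C(G)%g -> realized_by_coideal (KD_Delta C n a b) G.
Proof.
move=> nGb cGz; apply: (@twist_realizes _ _ _ (involution_twist C z b) v);
  rewrite ?star_gauge //.
- exact: Omega_gauge.
- suff -> : v * subgroup_projection C G = subgroup_projection C G * v.
    by rewrite -mulrA gaugeVK mulr1.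
  rewrite /gauge /klein_sum mulr_suml mulr_sumr; apply: eq_bigr => u _.
  rewrite -scalerAl projection_norm; first exact: scalerAr.
  by rewrite groupM // groupX // (subsetP (cent_sub _)).
- move=> g Gg; rewrite involution_twist_conj //=.
  (* lam g commutes with the complementary projections (1 + z)/2 and (1 - z)/2,
     which annihilates the two mixed terms. *)
  have gz : lam g * lam z = lam z * lam g :> A by rewrite !lamM (centP cGz).
  have lzz : lam z * lam z = 1 :> A by rewrite lamM zz.
  have pq : (1 + lam z) * (1 - lam z) = 0 :> A.
    by rewrite mulrBr mulr1 mulrDl mul1r lzz [lam z + 1]addrC subrr.
  have qp : (1 - lam z) * (1 + lam z) = 0 :> A.
    by rewrite mulrBl mul1r mulrDr mulr1 lzz [lam z + 1]addrC subrr.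
  rewrite -!scalerAl -!scalerAr -!mulrA.
  have -> : lam g * (1 - lam z) = (1 - lam z) * lam g :> A.
    by rewrite mulrBr mulrBl gz mul1r mulr1.
  have -> : lam g * (1 + lam z) = (1 + lam z) * lam g :> A.
    by rewrite mulrDr mulrDl gz mul1r mulr1.
  rewrite !mulrA pq qp !mul0r !scaler0 !linear0l addr0 add0r.
  have bJ : (b * g * b \in G)%g.
    have -> : (b * g * b = g ^ b)%g.
      rewrite conjgE mulgA; congr (_ * _ * _)%g.
      by apply/eqP; rewrite eq_sym eq_invg_mul bb.
    by rewrite memJ_norm.
  by rewrite memvD // mem_tensv ?memvf ?mem_subgroup_algebra.
Qed.

(** The character defining the gauge takes the value -1 at z, whereas z fixes
    the projection of G. *)
Lemma gauge_central_projection (G : {group gT}) :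
  z \in G -> v * subgroup_projection C G = subgroup_projection C G.
Proof.
move=> Gz; rewrite /gauge /klein_sum mulr_suml sum_V -!scalerAl.
rewrite -!lamM !expg1 !expg0 !lam1 !mulr1 !mul1r -mulrA.
rewrite !(lam_mul_projection C Gz).
have c0 : gauge_coef 'i (true, true) + gauge_coef 'i (true, false) = 0 :> C.
  by rewrite /gauge_coef /=; ring.
have c1 : gauge_coef 'i (false, true) + gauge_coef 'i (false, false) = 1 :> C.
  by rewrite /gauge_coef /=; ring.
by rewrite -!scalerDl c0 c1 scale0r scale1r add0r.
Qed.

(** The coideal subalgebra is v* C[G] v, with v = gauge 'i. *)
Lemma realized_of_mem (G : {group gT}) :
  z \in G -> realized_by_coideal (KD_Delta C n a b) G.
Proof.
move=> Gz; apply: (@twist_realizes _ _ _ (involution_twist C b z) vS);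
  rewrite ?star_gaugeN //.
- exact: Omega_star_gauge.
- have vp := gauge_central_projection Gz.
  have pv : subgroup_projection C G * vS = subgroup_projection C G.
    by rewrite -star_gauge // -{1}star_projection -starM vp star_projection.
  by rewrite -{1}vp mulrA gaugeKV mul1r -{1}pv -mulrA gaugeKV mulr1.
- move=> g Gg; rewrite involution_twist_conj //=.
  by rewrite !memvD // mem_tensv ?memvf ?mem_subgroup_algebra ?groupM.
Qed.

End Realization.

(** * The subgroups of the dihedral group *)

Lemma dihedral_relations (gT : finGroupType) (n : nat) (a b : gT) :
  dihedral_generators n a b ->
  [/\ a ^+ n * a ^+ n = 1, b * b = 1, a ^+ n * b = b * a ^+ n &
      forall k, b * a ^+ k = a ^- k * b]%g.
Proof.
move=> [_ a2n b2 ba].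
have bak k : (b * a ^+ k = a ^- k * b)%g.
  elim: k => [|k IHk]; first by rewrite invg1 mulg1 mul1g.
  by rewrite {1}expgSr mulgA IHk -mulgA ba mulgA -invMg -expgS.
have zz : (a ^+ n * a ^+ n = 1)%g by rewrite -expgD addnn -mul2n.
split=> //.
by rewrite bak; congr (_ * _)%g; apply/eqP; rewrite eq_sym eq_invg_mul zz.
Qed.

Lemma klein_four_group_set (gT : finGroupType) (z c : gT) :
  (z * z = 1 -> c * c = 1 -> z * c = c * z ->
  group_set [set 1; z; c; c * z])%g.
Proof.
move=> zz cc zc; apply/group_setP; split=> [|x y]; first by rewrite !inE eqxx.
have zcA t : (t * z * c = t * c * z)%g by rewrite -mulgA zc mulgA.
have zK t : (t * z * z = t)%g by rewrite -mulgA zz mulg1.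
have cK t : (t * c * c = t)%g by rewrite -mulgA cc mulg1.
pose simp := (mul1g, mulg1, mulgA, zz, cc, zc, zcA, zK, cK).
by rewrite !inE -!orbA => /or4P[] /eqP-> /or4P[] /eqP->;
  rewrite ?simp ?eqxx ?orbT.
Qed.

Theorem proposition5p11 (R : realType) (n : nat) (n_gt0 : (0 < n)%N)
    (a b : 'D_(4 * n)) (gen_ab : dihedral_generators n a b) :
  [/\ forall r : nat, (r < n)%N ->
        group_set (KD_H n a b r) /\
        realized_by_coideal (KD_Delta R[i] n a b) (KD_H n a b r),
      forall k d : nat, (0 < k)%N -> (0 < d)%N -> (2 * n = k * d)%N ->
        realized_by_coideal (KD_Delta R[i] n a b) (KD_A a k)
    & forall k d : nat, (0 < k)%N -> (0 < d)%N -> (2 * n = k * d)%N ->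
        realized_by_coideal (KD_Delta R[i] n a b) (KD_B a b k)].
Proof.
have [zz bb zb bak] := dihedral_relations gen_ab.
split=> [r _|k d _ _ _|k d _ _ _].
- have gH : group_set (KD_H n a b r).
    rewrite /KD_H expgD mulgA; apply: klein_four_group_set => //.
      by rewrite {1}bak mulgA -(mulgA _ b b) bb mulg1 mulVg.
    by rewrite mulgA zb -!mulgA -!expgD addnC.
  split=> //; apply: (realized_of_mem _ zz bb zb (G := Group gH)).
  by rewrite !inE eqxx orbT.
- apply: (realized_of_normalizer _ zz bb zb (G := <[a ^+ k]>%G)).
    have bV : (b^-1 = b)%g by apply/eqP; rewrite eq_invg_mul bb.
    rewrite -cycle_subG norms_cycle conjgE bV mulgA bak -mulgA bb mulg1.
    by rewrite groupV cycle_id.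
  by rewrite cent_cycle; apply/cent1P; apply: commuteX2.
- apply: (realized_of_normalizer _ zz bb zb (G := <<[set (a ^+ k)%g; b]>>%G)).
    by rewrite (subsetP (normG _)) // mem_gen // !inE eqxx orbT.
  rewrite cent_gen; apply/centP => _ /set2P[]-> //.
  exact: commuteX2.
Qed.
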